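(* For every tree $T$ on $n \ge 2$ vertices: (i) $\alpha_{\mathrm{reg}}(T) \ge \frac{n+2}{4}$ (Albertson and Boutin); (ii) $\alpha_{1-\mathrm{reg}}(T) \ge \frac{2(n+2)}{7}$; and (iii) $\alpha_{k-\mathrm{reg}}(T) \ge \frac{n+2}{3}$ for $k \ge 2$. Moreover, all bounds are sharp.
   Context: For an integer $k \ge 0$, a $k$-independent set of a graph $G$ is a set of vertices whose induced subgraph has maximum degree at most $k$. The regular $k$-independence number $\alpha_{k-\mathrm{reg}}(G)$ is the maximum cardinality of a $k$-independent set of $G$ all of whose vertices have the same degree in $G$. The regular independence number is $\alpha_{\mathrm{reg}}(G) = \alpha_{0-\mathrm{reg}}(G)$, i.e. the maximum cardinality of an independent set of $G$ all of whose vertices have the same degree in $G$. *)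

(* Defs.v *)
From mathcomp Require Import all_boot.
Set Implicit Arguments.
Unset Strict Implicit.
Unset Printing Implicit Defensive.

Record sgraph := SGraph {
  vertex :> finType;
  adj : rel vertex;
  adj_sym : symmetric adj;
  adj_irrefl : irreflexive adj
}.

Section Notions.
Variable G : sgraph.
Implicit Types (S : {set G}) (k : nat).

Definition connected_graph : Prop := forall x y : G, connect (@adj G) x y.

(* [ucycle] also holds of sequences of size at most 2: the empty one and the
   back-and-forth walks along an edge; graph cycles have length at least 3. *)
Definition acyclic_graph : Prop :=
  forall c : seq G, 2 < size c -> ~ ucycle (@adj G) c.

Definition tree : Prop := connected_graph /\ acyclic_graph.

Definition degree_in S (x : G) : nat := #|[set y in S | adj x y]|.

Definition degree (x : G) : nat := #|[set y | adj x y]|.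

Definition k_independent k S : bool := [forall x in S, degree_in S x <= k].

Definition equal_degrees S : bool :=
  [forall x in S, forall y in S, degree x == degree y].

(* The empty set satisfies the condition, so this maximum is never vacuous. *)
Definition alpha_kreg k : nat :=
  \max_(S : {set G} | k_independent k S && equal_degrees S) #|S|.

Definition alpha_reg : nat := alpha_kreg 0.

End Notions.

(* Main.v *)
(* Let n_d be the number of vertices of degree d. As a tree has n - 1 edges,
   2 n_1 + n_2 >= n + 2. The leaves are independent if n > 2, and the vertices
   of degree 2 induce a disjoint union of paths, which contains a k-independent
   set of size at least n_2 / 2, 2 n_2 / 3, n_2 for k = 0, k = 1, k >= 2. Hence
   n_1 <= alpha and n_2 <= 2 alpha, 3 alpha / 2, alpha respectively.

   Equality forces the remaining vertices to have degree 3. It is attained by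
   caterpillars with spine degrees 3 in which all pendant edges are subdivided
   twice (k = 0), every other one is subdivided three times (k = 1), or all are
   subdivided once (k >= 2). *)
Require Import Defs.
From mathcomp Require Import all_boot all_order all_algebra.
From mathcomp Require Import zify.
Import Order.TTheory GRing.Theory Num.Theory.
Set Implicit Arguments.
Unset Strict Implicit.
Unset Printing Implicit Defensive.
Local Open Scope nat_scope.

(** * Large k-independent sets in acyclic graphs *)

Section Forest.
Variable G : sgraph.
Implicit Types (S I K A : {set G}) (x y v : G) (k : nat).

Lemma k_independentP k S :
  reflect (forall x, x \in S -> degree_in S x <= k) (k_independent k S).
Proof. exact: forall_inP. Qed.

Lemma degree_in_sub S A x : S \subset A -> degree_in S x <= degree_in A x.
Proof.
move=> /subsetP SA; apply/subset_leq_card/subsetP => y.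
by rewrite !inE => /andP[/SA -> ->].
Qed.

Lemma degree_in_le_degree S x : degree_in S x <= degree x.
Proof. by apply/subset_leq_card/subsetP => y; rewrite !inE => /andP[]. Qed.

Lemma degree_in_lt_card S x : x \in S -> degree_in S x < #|S|.
Proof.
move=> xS; rewrite (cardsD1 x S) xS ltnS subset_leq_card //.
apply/subsetP => y; rewrite !inE => /andP[-> xy]; rewrite andbT.
by apply: contraTneq xy => ->; rewrite adj_irrefl.
Qed.

Lemma degree_in_setD1 S x v : v \in S ->
  degree_in S x = adj x v + degree_in (S :\ v) x.
Proof.
move=> vS; rewrite /degree_in (cardsD1 v) !inE vS /=; congr (_ + #|pred_of_set _|).
by apply/setP => y; rewrite !inE andbA.
Qed.

Lemma k_independent_leq k l S :
  k <= l -> k_independent k S -> k_independent l S.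
Proof.
move=> kl /k_independentP kS; apply/k_independentP => x xS.
exact: leq_trans (kS x xS) kl.
Qed.

Lemma k_independentU k K I :
  {in K & I, forall x y, ~~ adj x y} ->
  k_independent k K -> k_independent k I -> k_independent k (K :|: I).
Proof.
move=> KI /k_independentP kK /k_independentP kI; apply/k_independentP => x.
case/setUP => [xK|xI].
  apply: leq_trans (kK x xK); apply/subset_leq_card/subsetP => y.
  rewrite !inE => /andP[/orP[-> //|yI] xy].
  by have := KI x y xK yI; rewrite xy.
apply: leq_trans (kI x xI); apply/subset_leq_card/subsetP => y.
rewrite !inE => /andP[/orP[yK|->//] xy].
by have := KI y x yK xI; rewrite adj_sym xy.
Qed.

Lemma k_independent_small k S : #|S| <= k.+1 -> k_independent k S.
Proof.
move=> Sk; apply/k_independentP => x xS.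
by rewrite -ltnS (leq_trans (degree_in_lt_card xS)).
Qed.

Hypothesis acyclicG : acyclic_graph G.

(** Otherwise every path inside [S] extends at its head: the head has two neighbors in [S], one of
    them is not its predecessor, and acyclicity keeps that one off the path. Paths would then be
    arbitrarily long in a finite graph. *)
Lemma acyclic_low_degree S :
  S != set0 -> exists2 v, v \in S & degree_in S v <= 1.
Proof.
case/set0Pn => x0 x0S; apply/exists_inP; apply: contraT.
rewrite negb_exists_in => /forall_inP high.
suff long m : exists x p, [/\ path (@adj G) x p, uniq (x :: p),
    {subset x :: p <= S} & size p = m].
  have [x [p [_ up _ szp]]] := long #|G|.
  by have := max_card [in x :: p]; rewrite (card_uniqP up) /= szp ltnn.
elim: m => [|m [x [p [xp up pS szp]]]].
  by exists x0, [::]; split=> // y; rewrite inE => /eqP ->.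
have xS : x \in S by apply: pS; rewrite mem_head.
have [y [yS xy yp]] : exists y, [/\ y \in S, adj x y & y != head x p].
  have := high x xS; rewrite -ltnNge => /card_gt1P[y [z []]].
  rewrite !inE => /andP[yS xy] /andP[zS xz] yz.
  have [e|] := eqVneq y (head x p); last by exists y.
  by exists z; rewrite -e eq_sym.
have yx : y != x by apply: contraTneq xy => ->; rewrite adj_irrefl.
have ynp : y \notin p.
  apply/negP => yinp; case/splitPr: yinp xp up yp {pS szp} => p1 p2.
  rewrite cat_path => /andP[xp1 /= /andP[lp1 _]].
  rewrite -/(uniq (x :: _)) -cat_cons cat_uniq => /and3P[u1 h _] yh.
  (* If [y] were on the path, its initial segment up to [y] and the edge back to [x] would form a
     cycle, of length at least 3 because [y] is not the predecessor of [x]. *)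
  have := @acyclicG (x :: rcons p1 y); apply.
    by case: p1 yh {xp1 lp1 u1 h} => [|? [|? ?]] //=; rewrite eqxx.
  apply/andP; split; last first.
    rewrite -rcons_cons rcons_uniq u1 andbT.
    by apply: contra h => /= ->.
  by rewrite /= !rcons_path last_rcons xp1 lp1 adj_sym.
exists y, (x :: p); split => //=.
- by rewrite adj_sym xy.
- by move: up; rewrite /= inE negb_or yx ynp.
- by move=> z; rewrite inE => /predU1P[->//|]; apply: pS.
- by rewrite szp.
Qed.

(** Twice the edge bound |S| - 1 for a nonempty forest, with the boolean covering the empty set.
    Removing a vertex of degree at most 1 in [S] lowers the degree sum by at most 2; a last single
    vertex contributes 0. *)
Lemma acyclic_sum_degree S :
  \sum_(x in S) degree_in S x + 2 * (S != set0) <= 2 * #|S|.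
Proof.
have [m] := ubnP #|S|; elim: m S => // m IH S.
have [->|S0] := eqVneq S set0; first by rewrite big_set0 cards0.
have [v vS dv] := acyclic_low_degree S0.
have cS := cardsD1 v S; rewrite vS in cS.
move=> Sm; have {IH} IHv := IH (S :\ v) ltac:(lia).
rewrite (big_setD1 v) //=.
rewrite (eq_bigr (fun x => adj x v + degree_in (S :\ v) x)); last first.
  by move=> x _; exact: degree_in_setD1.
rewrite big_split /=.
have -> : \sum_(x in S :\ v) adj x v = degree_in S v.
  rewrite /degree_in -sum1dep_card big_mkcondr /= [RHS](big_setD1 v) //= adj_irrefl add0n.
  by apply: eq_bigr => x _; rewrite adj_sym; case: adj.
have [e|] := eqVneq (S :\ v) set0; last first.
  by move=> S'0; move: IHv; rewrite S'0; lia.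
have := degree_in_lt_card vS; rewrite cS e cards0 !big_set0; lia.
Qed.

(** Greedy choice: keep a vertex of degree at most 1 in [S] and discard its neighbor, if any, so
    that at least one of every two removed vertices is kept. *)
Lemma acyclic_independent S :
  exists I, [/\ I \subset S, k_independent 0 I & #|S| <= 2 * #|I|].
Proof.
have [m] := ubnP #|S|; elim: m S => // m IH S Sm.
have [->|S0] := eqVneq S set0.
  by exists set0; rewrite sub0set cards0 k_independent_small ?cards0.
have [v vS dv] := acyclic_low_degree S0.
pose A := v |: [set y in S | adj v y].
have AS : A \subset S.
  by apply/subsetP => y; rewrite !inE => /predU1P[->//|/andP[]].
have vA : v \in A by rewrite setU11.
have cA : #|A| <= 2 by rewrite cardsU1; move: dv; rewrite /degree_in; lia.
have cS : #|S| = #|A| + #|S :\: A| by rewrite -(cardsID A) (setIidPr AS).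
have A0 : 0 < #|A| by apply/card_gt0P; exists v.
have [|I [IS kI cI]] := IH (S :\: A); first lia.
have vI : v \notin I.
  by apply: contraL vA => /(subsetP IS); rewrite inE => /andP[].
exists (v |: I); split.
- by rewrite subUset sub1set vS (subset_trans IS) ?subsetDl.
- apply: k_independentU => //; last by rewrite k_independent_small ?cards1.
  move=> x y /set1P -> /(subsetP IS); rewrite !inE negb_or => /andP[/andP[_ h] yS].
  by rewrite yS in h.
- by rewrite cardsU1 vI; lia.
Qed.

(* The subgraph induced by [S] is a union of paths: peel three vertices at a
   time off an end, keeping the first two. *)
Lemma acyclic_1_independent S : {in S, forall x, degree_in S x <= 2} ->
  exists I, [/\ I \subset S, k_independent 1 I & 2 * #|S| <= 3 * #|I|].
Proof.
have [m] := ubnP #|S|; elim: m S => // m IH S Sm d2.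
have [->|S0] := eqVneq S set0.
  by exists set0; rewrite sub0set cards0 k_independent_small ?cards0.
have [v vS dv] := acyclic_low_degree S0.
(* [K] is kept and [A] removed. Since [A] contains all neighbors of [K] in [S], no edge joins [K] to
   the set found in the rest. *)
suff [K [A [KA AS K0 K2 [cKA NK]]]] : exists K A, [/\ K \subset A, A \subset S,
    K != set0, #|K| <= 2 & 2 * #|A| <= 3 * #|K| /\
    forall x y, x \in K -> y \in S -> adj x y -> y \in A].
  have cS : #|S| = #|A| + #|S :\: A| by rewrite -(cardsID A) (setIidPr AS).
  have K1 : 0 < #|K| by rewrite card_gt0.
  have := subset_leq_card KA => cKA'.
  have [||I [IS kI cI]] := IH (S :\: A); first lia.
    move=> x; rewrite inE => /andP[_ xS].
    exact: leq_trans (degree_in_sub x (subsetDl _ _)) (d2 x xS).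
  have dKI : [disjoint K & I].
    rewrite (disjointWl KA) // (disjointWr IS) // -setI_eq0.
    by rewrite setIDA setIC -setIDA setDv setI0.
  exists (K :|: I); split.
  - by rewrite subUset (subset_trans KA) // (subset_trans IS) ?subsetDl.
  - apply: k_independentU => //; last exact: k_independent_small.
    move=> x y xK /(subsetP IS); rewrite !inE => /andP[yA yS].
    by apply: contra yA; apply: NK xK yS.
  - by move: dKI; rewrite -leq_card_setU => /eqP ->; lia.
have [e|/set0Pn[w]] := eqVneq [set y in S | adj v y] set0.
  exists [set v], [set v]; split; rewrite ?sub1set ?cards1 ?set11 //.
  - by apply/set0Pn; exists v; rewrite inE.
  - split=> // x y /set1P -> yS vy.
    by have := in_set0 y; rewrite -e inE yS vy.
rewrite inE => /andP[wS vw].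
have vNw y : y \in S -> adj v y -> y = w.
  move=> yS vy; apply/eqP; apply: contraLR dv => yw; rewrite -ltnNge.
  by apply/card_gt1P; exists y, w; rewrite !inE yS vy wS vw.
pose N := [set y in S | adj w y].
have vN : v \in N by rewrite inE vS adj_sym.
have vw' : v != w by apply: contraTneq vw => ->; rewrite adj_irrefl.
exists [set v; w], (w |: N); split.
- by rewrite subUset !sub1set !inE vS eqxx adj_sym vw orbT.
- by rewrite subUset sub1set wS; apply/subsetP => y; rewrite inE => /andP[].
- by apply/set0Pn; exists v; rewrite !inE eqxx.
- by rewrite cards2; case: (_ != _).
split.
  (* Here [A] is [w] with its at most two neighbors in [S], one of them [v]: at most three vertices
     removed, two kept. *)
  have := d2 w wS; rewrite /degree_in -/N cards2 vw' cardsU1; lia.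
move=> x y /set2P[] -> yS; last by move=> wy; rewrite !inE yS wy orbT.
by move/(vNw y yS) => ->; rewrite setU11.
Qed.

End Forest.

(** * Lower bounds from the leaves and the vertices of degree 2 *)

Section LowerBounds.
Variable T : sgraph.
Implicit Types (S : {set T}) (x y : T) (k : nat).

Definition degree_class d : {set T} := [set x | degree x == d].

Lemma equal_degrees_class d S : S \subset degree_class d -> equal_degrees S.
Proof.
move=> /subsetP Sd; apply/forall_inP => x /Sd; rewrite inE => /eqP xd.
by apply/forall_inP => y /Sd; rewrite inE xd eq_sym.
Qed.

Lemma leq_alpha k d S :
  S \subset degree_class d -> k_independent k S -> #|S| <= alpha_kreg T k.
Proof.
move=> /equal_degrees_class eS kS.
by apply: (@leq_bigmax_cond _ _ (fun S : {set T} => #|S|)); rewrite kS eS.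
Qed.

Hypotheses (treeT : tree T) (T2 : 2 <= #|T|).

Lemma tree_degree_gt0 x : 0 < degree x.
Proof.
have [y yx] : exists y, y != x.
  have /card_gt1P[y [z [_ _ yz]]] := T2.
  by have [e|] := eqVneq y x; [exists z; rewrite -e eq_sym | exists y].
have /connectP[[|z p] /= h e] := treeT.1 x y; first by rewrite e eqxx in yx.
by apply/card_gt0P; exists z; rewrite inE; case/andP: h.
Qed.

(** Every d >= 1 satisfies 3 <= d + 2 [d = 1] + [d = 2]. Sum this over all vertices and bound the
    degree sum by 2 n - 2. *)
Lemma tree_leaves_bound :
  #|T| + 2 <= 2 * #|degree_class 1| + #|degree_class 2|.
Proof.
have := acyclic_sum_degree treeT.2 [set: T]; rewrite cardsT.
have -> : [set: T] != set0 by rewrite -card_gt0 cardsT; lia.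
rewrite (eq_bigr (@degree T)); last first.
  by move=> x _; apply: eq_card => y; rewrite !inE.
have : \sum_(x : T) 3 <= \sum_(x : T) (degree x + 2 * (degree x == 1) + (degree x == 2)).
  by apply: leq_sum => x _; have := tree_degree_gt0 x; lia.
have cE d : \sum_(x : T) (degree x == d) = #|degree_class d|.
  by rewrite -sum1dep_card [RHS]big_mkcond; apply: eq_bigr => x _; case: eqP.
rewrite sum_nat_const !big_split /= !cE.
rewrite [\sum_(i in setT) _](eq_bigl xpredT) => [|x]; last by rewrite inE.
rewrite big1_eq -[#|xpredT|]/#|T|; lia.
Qed.

Lemma leaves_1_independent : k_independent 1 (degree_class 1).
Proof.
apply/k_independentP => x; rewrite inE => /eqP <-.
exact: degree_in_le_degree.
Qed.

(** Two adjacent leaves are closed under adjacency, so by connectedness they would be the whole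
    tree. *)
Lemma leaves_independent : 2 < #|T| -> k_independent 0 (degree_class 1).
Proof.
move=> T3; apply/k_independentP => x; rewrite inE => /eqP x1.
rewrite leqn0; apply: contraTT T3; rewrite -lt0n => /card_gt0P[y].
rewrite !inE => /andP[/eqP y1 xy].
have only (u v w : T) : degree u = 1 -> adj u v -> adj u w -> w = v.
  move=> u1 uv uw; apply/eqP; apply: contra_eqT u1 => wv.
  rewrite neq_ltn orbC; apply/orP; left.
  by apply/card_gt1P; exists w, v; rewrite !inE.
have cl u v : adj u v -> u \in [set x; y] -> v \in [set x; y].
  move=> uv /set2P[] e; rewrite e in uv.
    by rewrite (only x y v) ?set22.
  by rewrite (only y x v) ?set21 // adj_sym.
rewrite -leqNgt -cardsT; apply: (@leq_trans #|[set x; y]|).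
  apply/subset_leq_card/subsetP => z _.
  rewrite -(closed_connect _ (treeT.1 x z)) ?inE ?eqxx // => u v uv.
  by apply/idP/idP; apply: cl; rewrite // adj_sym.
by rewrite cards2; case: (_ != _).
Qed.

Lemma tree_degree2_independent k : 2 <= k -> k_independent k (degree_class 2).
Proof.
move=> k2; apply/k_independentP => x; rewrite inE => /eqP d2.
by rewrite (leq_trans (degree_in_le_degree _ _)) // d2.
Qed.

Lemma alpha_reg_lower : #|T| + 2 <= 4 * alpha_reg T.
Proof.
have [T3|T2'] := ltnP 2 #|T|; last first.
  (* On two vertices the leaves are adjacent, but a single vertex already attains (2 + 2) / 4 =
     1. *)
  have /card_gt0P[x _] : 0 < #|T| by lia.
  have := @leq_alpha 0 (degree x) [set x]; rewrite cards1 sub1set inE eqxx.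
  by rewrite k_independent_small ?cards1 // => /(_ isT isT); rewrite /alpha_reg; lia.
have := leq_alpha (subxx _) (leaves_independent T3).
have [I [IS kI cI]] := acyclic_independent treeT.2 (degree_class 2).
have := leq_alpha IS kI; have := tree_leaves_bound; rewrite /alpha_reg; lia.
Qed.

Lemma alpha_1reg_lower : 2 * (#|T| + 2) <= 7 * alpha_kreg T 1.
Proof.
have := leq_alpha (subxx _) leaves_1_independent.
have [|I [IS kI cI]] := @acyclic_1_independent _ treeT.2 (degree_class 2).
  by apply/k_independentP/tree_degree2_independent.
have := leq_alpha IS kI; have := tree_leaves_bound; lia.
Qed.

Lemma alpha_kreg_lower k : 2 <= k -> #|T| + 2 <= 3 * alpha_kreg T k.
Proof.
move=> k2; have k1 : 1 <= k by lia.
have := leq_alpha (subxx _) (k_independent_leq k1 leaves_1_independent).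
have := leq_alpha (subxx _) (tree_degree2_independent k2).
have := tree_leaves_bound; lia.
Qed.

End LowerBounds.

(** * Trees on initial segments of the integers, given by a parent function *)

Section ParentTree.
Variables (p : nat -> nat) (n : nat).

(** The strict inequalities leave the root 0 without a parent and make the relation irreflexive for
    every [p]. *)
Definition parent_adj (x y : nat) : bool :=
  ((y < x) && (p x == y)) || ((x < y) && (p y == x)).

Lemma parent_adj_sym : symmetric (fun x y : 'I_n => parent_adj x y).
Proof. by move=> x y; rewrite /parent_adj orbC. Qed.

Lemma parent_adj_irrefl : irreflexive (fun x y : 'I_n => parent_adj x y).
Proof. by move=> x; rewrite /parent_adj ltnn. Qed.

Definition parent_tree := SGraph parent_adj_sym parent_adj_irrefl.

Hypothesis p_lt : forall x, 0 < x < n -> p x < x.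

Lemma parent_tree_connected : connected_graph parent_tree.
Proof.
move=> x y; have sym := sym_connect_sym (@adj_sym parent_tree).
have n0 : 0 < n := leq_ltn_trans (leq0n x) (ltn_ord x).
suff root z : connect (@adj parent_tree) (Ordinal n0) z.
  by apply: connect_trans (root y); rewrite sym.
case: z => m; elim/ltn_ind: m => m IH mn.
have [m0|m0] := posnP m.
  by rewrite (_ : Ordinal mn = Ordinal n0) ?connect0 //; apply: val_inj.
have pm : p m < m by rewrite p_lt ?m0.
apply: connect_trans (IH _ pm (ltn_trans pm mn)) (connect1 _).
by rewrite /= /parent_adj /= pm eqxx orbT.
Qed.

(* The two neighbors on a cycle of its largest vertex would both be the parent
   of that vertex. *)
Lemma parent_tree_acyclic : acyclic_graph parent_tree.
Proof.
move=> c c3 cc.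
have [x0 x0c] : exists x0, x0 \in c.
  by case: c c3 {cc} => // a c _; exists a; rewrite mem_head.
have [x xc xmax] : exists2 x, x \in c & forall y, y \in c -> y <= x.
  by case: (@arg_maxnP _ x0 (mem c) (@nat_of_ord n) x0c) => x; exists x.
have [i s rs] := rot_to xc.
have s2 : 1 < size s by rewrite -ltnS -[(size s).+1]/(size (x :: s)) -rs size_rot.
have par y : y \in s -> parent_adj x y -> p x = y.
  move=> ys; have yx : y <= x by rewrite xmax // -(mem_rot i) rs inE ys orbT.
  by rewrite /parent_adj [x < y]ltnNge yx orbF => /andP[_ /eqP].
move: cc; rewrite -(rot_ucycle i) rs => /andP[].
case: s s2 par {rs} => // y [//|z s] _ par /=.
rewrite rcons_path /= => /and4P[xy _ _ lx] /and4P[_ ys _ _].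
case/negP: ys; suff -> : y = last z s by rewrite mem_last.
apply: ord_inj; rewrite -(par y) ?mem_head //; apply: par.
  by rewrite inE mem_last orbT.
by rewrite /parent_adj orbC.
Qed.

Lemma parent_tree_tree : tree parent_tree.
Proof. by split; [exact: parent_tree_connected | exact: parent_tree_acyclic]. Qed.

(** When [ds] contains all gaps between a vertex and its parent, the children of [x] are found among
    the [x + d], so the degree reduces to a few arithmetic tests. *)
Lemma parent_tree_degree (ds : seq nat) (x : parent_tree) :
  uniq ds -> (forall y, 0 < y < n -> y - p y \in ds) -> 0 \notin ds ->
  degree x = (0 < x) + count (fun d => (x + d < n) && (p (x + d) == x)) ds.
Proof.
move=> uds pds ds0; have xn : x < n := ltn_ord x.
pose a := fun d => (x + d < n) && (p (x + d) == x).
pose s := nseq (0 < x) (p x) ++ map (addn x) (filter a ds).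
have -> : degree x = count (parent_adj x) (iota 0 n).
  rewrite /degree -sum1dep_card -(big_mkord (parent_adj x) (fun=> 1)) sum1_count.
  by rewrite /index_iota subn0.
transitivity (size s); last by rewrite size_cat size_nseq size_map size_filter.
rewrite -size_filter; apply/perm_size/uniq_perm.
- by rewrite filter_uniq ?iota_uniq.
- rewrite cat_uniq (map_inj_uniq (@addnI x)) filter_uniq // andbT.
  rewrite (_ : uniq _) /=; last by case: (0 < x).
  apply/hasPn => _ /mapP[d _ ->]; rewrite mem_nseq; apply/negP => /andP[x0 /eqP e].
  by have := @p_lt x; lia.
move=> y; rewrite mem_filter mem_iota /= add0n mem_cat mem_nseq /parent_adj lt0b.
apply/andP/orP => [[/orP[/andP[yx /eqP <-]|/andP[xy /eqP e]] yn]|].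
- by left; lia.
- right; apply/mapP; exists (y - x); last lia.
  by rewrite mem_filter /a subnKC ?e ?eqxx ?yn ?(ltnW xy) //= -[in X in _ - X]e pds; lia.
case=> [/andP[x0 /eqP->]|/mapP[d]].
  by rewrite eqxx p_lt ?x0 //; have := @p_lt x; lia.
rewrite mem_filter => /andP[/andP[xdn pxd] dds] ->; split=> //.
have d0 : d != 0 by apply: contraNneq ds0 => <-.
by rewrite pxd andbT; lia.
Qed.

End ParentTree.

(** * Extremal caterpillars, with upper bounds obtained block by block *)

Lemma card_fiber_bound (T : finType) (S : {set T}) (f : T -> nat) q c :
  (forall x, f x < q) -> (forall j, #|[set x in S | f x == j]| <= c) ->
  #|S| <= q * c.
Proof.
move=> fq fc; rewrite -sum1_card.
rewrite (partition_big (fun x => Ordinal (fq x)) xpredT) //=.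
rewrite -[q in q * c]card_ord -sum_nat_const; apply: leq_sum => j _.
apply: leq_trans (fc j); rewrite -sum1dep_card.
by apply: eq_leq; apply: eq_bigl => x.
Qed.

Lemma alpha_upper (G : sgraph) k (f : G -> nat) q c :
  (forall x, f x < q) ->
  (forall S j, k_independent k S -> equal_degrees S ->
     #|[set x in S | f x == j]| <= c) ->
  alpha_kreg G k <= q * c.
Proof.
move=> fq fc; apply/bigmax_leqP => S /andP[kS eS].
by apply: card_fiber_bound fq _ => j; apply: fc.
Qed.

(* [comb_parent l] makes 0, ..., l - 2 a path from a leaf and continues with
   blocks of [l] vertices: a spine vertex congruent to -1 modulo [l], followed
   by a pendant path. With [l * (t + 2) - 2] vertices this is the cubic
   caterpillar with [t + 2] leaves whose pendant edges are subdivided [l - 2]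
   times: the last spine vertex has degree 2 and belongs to a pendant path. *)
Definition comb_parent (l i : nat) : nat :=
  if (i %% l == l.-1) && (l <= i) then i - l else i.-1.

Definition comb l t := parent_tree (comb_parent l) (l * t.+2 - 2).

Lemma comb_parent_lt l i : 0 < l -> 0 < i -> comb_parent l i < i.
Proof. by rewrite /comb_parent; case: ifP; lia. Qed.

Lemma comb_tree l t : 0 < l -> tree (comb l t).
Proof.
by move=> l0; apply: parent_tree_tree => x /andP[x0 _]; apply: comb_parent_lt.
Qed.

Lemma comb_degree_sum l t (x : comb l t) : 1 < l ->
  degree x = (0 < x) +
    ((x.+1 < l * t.+2 - 2) && ((x.+1 %% l != l.-1) || (x.+1 < l))) +
    ((x + l < l * t.+2 - 2) && (x %% l == l.-1)).
Proof.
move=> l1; rewrite (@parent_tree_degree _ _ _ [:: 1; l]).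
- rewrite /= addn1 addn0 addnA /comb_parent modnDr leq_addl andbT.
  congr (_ + _ + _); congr (nat_of_bool (_ && _)).
    by case: ifP; lia.
  by case: ifP; lia.
- by move=> y /andP[y0 _]; apply: comb_parent_lt; lia.
- by rewrite /= inE; lia.
- by move=> y /andP[y0 _]; rewrite !inE /comb_parent; case: ifP; lia.
- by rewrite !inE; lia.
Qed.

(** With the shift [x.+1], each block starts at its spine vertex. The first block has none, so its
    entry 0 is a dummy; the last block is one vertex short and its spine vertex has degree 2. *)
Lemma comb4_degree t (x : comb 4 t) : degree x =
  nth 0 (if x.+1 < 4 then [:: 0; 1; 2; 2] else
         if x.+1 < 4 * t.+1 then [:: 3; 2; 2; 1] else [:: 2; 2; 1]) (x.+1 %% 4).
Proof.
rewrite comb_degree_sum // (_ : (x %% 4 == 3) = (x.+1 %% 4 == 0)); last lia.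
have := ltn_ord x; have := divn_eq x.+1 4; have := ltn_mod x.+1 4.
move: (x.+1 %/ 4) (x.+1 %% 4) => q r.
by case: r => [|[|[|[|r]]]] //= _ e xn; do 2?case: ifP => /=; lia.
Qed.

Lemma comb3_degree t (x : comb 3 t) : degree x =
  nth 0 (if x.+1 < 3 then [:: 0; 1; 2] else
         if x.+1 < 3 * t.+1 then [:: 3; 2; 1] else [:: 2; 1]) (x.+1 %% 3).
Proof.
rewrite comb_degree_sum // (_ : (x %% 3 == 2) = (x.+1 %% 3 == 0)); last lia.
have := ltn_ord x; have := divn_eq x.+1 3; have := ltn_mod x.+1 3.
move: (x.+1 %/ 3) (x.+1 %% 3) => q r.
by case: r => [|[|[|r]]] //= _ e xn; do 2?case: ifP => /=; lia.
Qed.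

(** Within a block only degree 2 repeats, and it does so on two consecutive vertices of a path.
    Hence a regular independent set has at most one vertex per block. *)
Lemma comb4_degree_eq t (x y : comb 4 t) : x.+1 %/ 4 = y.+1 %/ 4 ->
  degree x = degree y -> x != y -> adj x y.
Proof.
wlog xy : x y / x < y => [th xy4 dxy xy|].
  have [lt|lt|/val_inj e] := ltngtP x y; first exact: th.
    by rewrite adj_sym th // eq_sym.
  by rewrite e eqxx in xy.
move=> xy4; rewrite !comb4_degree.
have -> : (y.+1 < 4) = (x.+1 < 4) by lia.
have -> : (y.+1 < 4 * t.+1) = (x.+1 < 4 * t.+1) by lia.
have xn := ltn_ord x; have yn := ltn_ord y; move=> dxy _.
have e : y.+1 %% 4 = (x.+1 %% 4).+1.
  have : x.+1 %% 4 < y.+1 %% 4 by lia.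
  have := ltn_mod y.+1 4; move: dxy; move: (x.+1 %% 4) (y.+1 %% 4) => a b.
  do 2?case: ifP => _; case: a => [|[|[|a]]];
    by case: b => [|[|[|[|b]]]].
have {}e : y = x.+1 :> nat by lia.
(* [y] is not the first of its block, hence not a spine vertex, and its parent is its predecessor
   [x]. *)
have y4 : y %% 4 < 3 by lia.
apply/orP; right; rewrite xy /comb_parent.
by case: ifP; lia.
Qed.

(** The degrees in a block are 1, 2 or 3, 2, 1 or 2, 1, without repetition, which bounds regular
    sets for all [k] at once. *)
Lemma comb3_degree_inj t (x y : comb 3 t) : x.+1 %/ 3 = y.+1 %/ 3 ->
  degree x = degree y -> x = y.
Proof.
move=> xy3; rewrite !comb3_degree.
have -> : (y.+1 < 3) = (x.+1 < 3) by lia.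
have -> : (y.+1 < 3 * t.+1) = (x.+1 < 3 * t.+1) by lia.
move=> dxy; apply: ord_inj; suff: x.+1 %% 3 = y.+1 %% 3 by lia.
have := ltn_mod x.+1 3; have := ltn_mod y.+1 3; move: dxy.
move: (x.+1 %% 3) (y.+1 %% 3) => a b.
by do 2?case: ifP => _; case: a => [|[|[|a]]] //; case: b => [|[|[|b]]].
Qed.

Lemma alpha_comb4_upper t : alpha_reg (comb 4 t) <= t.+2.
Proof.
rewrite -[t.+2]muln1; apply: (@alpha_upper _ _ (fun x : comb 4 t => x.+1 %/ 4)).
  by move=> x; have := ltn_ord x; lia.
move=> S j /k_independentP kS /forall_inP eS; rewrite leqNgt; apply/negP.
case/card_gt1P => x [y []]; rewrite !inE => /andP[xS /eqP xj] /andP[yS /eqP yj] xy.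
have := kS x xS; rewrite leqNgt => /negP; apply.
apply/card_gt0P; exists y; rewrite inE yS comb4_degree_eq ?xj ?yj //.
exact/eqP/(forall_inP (eS x xS)).
Qed.

Lemma alpha_comb3_upper t k : alpha_kreg (comb 3 t) k <= t.+2.
Proof.
rewrite -[t.+2]muln1; apply: (@alpha_upper _ _ (fun x : comb 3 t => x.+1 %/ 3)).
  by move=> x; have := ltn_ord x; lia.
move=> S j _ /forall_inP eS; rewrite leqNgt; apply/negP.
case/card_gt1P => x [y []]; rewrite !inE => /andP[xS /eqP xj] /andP[yS /eqP yj].
case/eqP; apply: comb3_degree_inj; first by rewrite xj yj.
exact/eqP/(forall_inP (eS x xS)).
Qed.

(* The cubic caterpillar with [2 * t + 2] leaves in which every other pendant
   edge is subdivided three times. A block of 7 vertices consists of a bare leaf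
   (attached to the previous block), a spine vertex, its subdivided pendant
   path, and the spine vertex holding the bare leaf of the next block. *)
Definition comb7_parent (i : nat) : nat :=
  if i %% 7 == 1 then i - 2 else if i %% 7 == 6 then i - 5 else i.-1.

Definition comb7 t := parent_tree comb7_parent (7 * t + 5).

Lemma comb7_parent_lt i : 0 < i -> comb7_parent i < i.
Proof. by rewrite /comb7_parent; do 2?case: ifP; lia. Qed.

Lemma comb7_tree t : tree (comb7 t).
Proof.
by apply: parent_tree_tree => x /andP[x0 _]; apply: comb7_parent_lt.
Qed.

(** Truncated subtraction makes 0 the parent of 1, hence the clause [x == 0]; the other bare leaves
    have no child. *)
Lemma comb7_degree_sum t (x : comb7 t) :
  degree x = (0 < x) +
    ((x.+1 < 7 * t + 5) && [|| x == 0 :> nat | (x %% 7 != 0) && (x %% 7 != 5)])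
    + ((x + 2 < 7 * t + 5) && (x %% 7 == 6))
    + ((x + 5 < 7 * t + 5) && (x %% 7 == 1)).
Proof.
rewrite (@parent_tree_degree _ _ _ [:: 1; 2; 5]) //.
- rewrite /= addn1 addn0 !addnA /comb7_parent.
  by congr (_ + _ + _ + _); congr (nat_of_bool (_ && _)); do 2?case: ifP; lia.
- by move=> y /andP[y0 _]; apply: comb7_parent_lt; lia.
- by move=> y /andP[y0 _]; rewrite !inE /comb7_parent; do 2?case: ifP; lia.
Qed.

Lemma comb7_degree t (x : comb7 t) : degree x =
  nth 0 (if x < 7 * t then [:: 1; 3; 2; 2; 2; 1; 3] else [:: 1; 2; 2; 2; 1])
    (x %% 7).
Proof.
rewrite comb7_degree_sum.
have := ltn_ord x; have := divn_eq x 7; have := ltn_mod x 7.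
move: (x %/ 7) (x %% 7) => q r.
by do 7?[case: r => [|r] /=]; move=> // _ e xn; case: ifP => /=; lia.
Qed.

(** In a block only degree 2 occurs three times, on three consecutive path vertices. A regular
    1-independent set therefore has at most two vertices per block. *)
Lemma comb7_degree_eq t (x y z : comb7 t) : x < y -> y < z ->
  x %/ 7 = y %/ 7 -> y %/ 7 = z %/ 7 ->
  degree x = degree y -> degree y = degree z -> adj y x /\ adj y z.
Proof.
move=> xy yz xy7 yz7; rewrite !comb7_degree.
have -> : (x < 7 * t) = (y < 7 * t) by lia.
have -> : (z < 7 * t) = (y < 7 * t) by lia.
move=> dxy dyz.
have [ex ez y1 y4] : [/\ y %% 7 = (x %% 7).+1, z %% 7 = (y %% 7).+1,
    1 < y %% 7 & y %% 7 < 5].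
  have : x %% 7 < y %% 7 by lia.
  have : y %% 7 < z %% 7 by lia.
  have := ltn_mod z 7; move: dxy dyz.
  move: (x %% 7) (y %% 7) (z %% 7) => a b c dab dbc c7 bc ab.
  move: dab dbc; case: ifP => _.
    by do 6?[case: a ab => [|a] ab //]; do 7?[case: b ab bc => [|b] ab bc //=];
      do 7?[case: c c7 bc => [|c] c7 bc //=].
  by do 6?[case: a ab => [|a] ab //]; do 7?[case: b ab bc => [|b] ab bc //=];
      do 7?[case: c c7 bc => [|c] c7 bc //=].
have {}ex : y = x.+1 :> nat by lia.
have {}ez : z = y.+1 :> nat by lia.
split; apply/orP; [left | right]; rewrite ?xy ?yz /comb7_parent.
  by rewrite !ifF; lia.
by rewrite ez !ifF; lia.
Qed.

Lemma card_gt2_ltn n (A : {set 'I_n}) : 2 < #|A| ->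
  exists x y z, [/\ x \in A, y \in A, z \in A, x < y & y < z].
Proof.
case/card_gt2P => x [y [z [[xA yA zA] [xy yz zx]]]].
move: xy yz zx; rewrite -!val_eqE /=.
case: (ltngtP x y) (ltngtP y z) (ltngtP z x) => // xy [] // yz [] // zx _ _ _.
- by lia.
- by exists x, y, z.
- by exists z, x, y.
- by exists x, z, y.
- by exists y, z, x.
- by exists y, x, z.
- by exists z, y, x.
- by lia.
Qed.

Lemma alpha_comb7_upper t : alpha_kreg (comb7 t) 1 <= t.+1 * 2.
Proof.
apply: (@alpha_upper _ _ (fun x : comb7 t => x %/ 7)).
  by move=> x; have := ltn_ord x; lia.
move=> S j /k_independentP kS /forall_inP eS; rewrite leqNgt; apply/negP.
case/card_gt2_ltn => x [y [z []]]; rewrite !inE.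
move=> /andP[xS /eqP xj] /andP[yS /eqP yj] /andP[zS /eqP zj] xy yz.
have [|||| yx yz'] := comb7_degree_eq xy yz.
- by rewrite xj yj.
- by rewrite zj yj.
- exact/eqP/(forall_inP (eS x xS)).
- exact/eqP/(forall_inP (eS y yS)).
have := kS y yS; rewrite leqNgt => /negP; apply.
apply/card_gt1P; exists x, z; rewrite !inE xS zS yx yz' -val_eqE /=.
by split=> //; lia.
Qed.

(** * The bounds over the rationals and their sharpness *)

Local Open Scope ring_scope.

Lemma ratio_le (a b c d : nat) : (0 < c)%N ->
  (a%:R * (b%:R + 2) / c%:R <= d%:R :> rat) = (a * (b + 2) <= c * d)%N.
Proof.
move=> c0; rewrite ler_pdivrMr ?ltr0n // -natrD -!natrM ler_nat.
by rewrite [(d * c)%N]mulnC.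
Qed.

Lemma ratio_eq (a b c d : nat) : (0 < c)%N ->
  (a * (b + 2) = c * d)%N -> d%:R = a%:R * (b%:R + 2) / c%:R :> rat.
Proof.
move=> c0 e; rewrite -natrD -natrM e natrM mulrC mulKf //.
by rewrite pnatr_eq0 -lt0n.
Qed.

Theorem theorem2p1 :
  (forall T : sgraph, tree T -> (2 <= #|T|)%N ->
     [/\ (#|T|%:R + 2) / 4 <= (alpha_reg T)%:R :> rat,
         2 * (#|T|%:R + 2) / 7 <= (alpha_kreg T 1)%:R :> rat
       & forall k : nat, (2 <= k)%N ->
           (#|T|%:R + 2) / 3 <= (alpha_kreg T k)%:R :> rat])
  /\
  [/\ forall N : nat, exists T : sgraph,
        [/\ tree T, (2 <= #|T|)%N, (N <= #|T|)%N
          & (alpha_reg T)%:R = (#|T|%:R + 2) / 4 :> rat],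
      forall N : nat, exists T : sgraph,
        [/\ tree T, (2 <= #|T|)%N, (N <= #|T|)%N
          & (alpha_kreg T 1)%:R = 2 * (#|T|%:R + 2) / 7 :> rat]
    & forall k : nat, (2 <= k)%N -> forall N : nat, exists T : sgraph,
        [/\ tree T, (2 <= #|T|)%N, (N <= #|T|)%N
          & (alpha_kreg T k)%:R = (#|T|%:R + 2) / 3 :> rat]].
Proof.
split=> [T treeT T2|].
  split=> [||k k2].
  - by rewrite -[_ + 2]mul1r (ratio_le 1 _ _ (isT : 0 < 4)%N) mul1n alpha_reg_lower.
  - by rewrite (ratio_le 2 _ _ (isT : 0 < 7)%N) alpha_1reg_lower.
  - by rewrite -[_ + 2]mul1r (ratio_le 1 _ _ (isT : 0 < 3)%N) mul1n alpha_kreg_lower.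
split=> [N|N|k k2 N].
- have card_comb : #|comb 4 N| = (4 * N.+2 - 2)%N by rewrite card_ord.
  have T2 : (2 <= #|comb 4 N|)%N by lia.
  exists (comb 4 N); split=> //; [exact: comb_tree | lia |].
  (* The order n = 4 (N + 2) - 2 makes (n + 2) / 4 equal to the upper bound N + 2, so both bounds
     meet. *)
  rewrite -[_ + 2]mul1r; apply: (@ratio_eq 1) => //.
  have := alpha_reg_lower (@comb_tree 4 N isT) T2; have := alpha_comb4_upper N; lia.
- have card_comb : #|comb7 N| = (7 * N + 5)%N by rewrite card_ord.
  have T2 : (2 <= #|comb7 N|)%N by lia.
  exists (comb7 N); split=> //; [exact: comb7_tree | lia |].
  apply: ratio_eq => //.
  have := alpha_1reg_lower (comb7_tree N) T2; have := alpha_comb7_upper N; lia.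
- have card_comb : #|comb 3 N| = (3 * N.+2 - 2)%N by rewrite card_ord.
  have T2 : (2 <= #|comb 3 N|)%N by lia.
  exists (comb 3 N); split=> //; [exact: comb_tree | lia |].
  rewrite -[_ + 2]mul1r; apply: (@ratio_eq 1) => //.
  have := alpha_kreg_lower (@comb_tree 3 N isT) T2 k2.
  have := alpha_comb3_upper N k; lia.
Qed.
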